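(* Consider the restart procedure described in the context, under assumptions (1)–(3) of the context, and let $T:=\left\lceil \frac{t_m}{\lambda}\right\rceil$. Then: (1) $\displaystyle \mathbb{P}\left(\bigcap_{t=1}^{T}\left\{\lim_{k\to\infty}\hat p_k(t)=p(t)\right\}\right)=1$; (2) $\displaystyle \mathbb{P}\left(\lim_{k\to\infty}\hat\sigma_k=t_m\right)=1$.
   Context: Underlying algorithm. Let $f$ be a real-valued function on a finite set $S$, and let $f_m=\min_{x\in S} f(x)$. A stochastic algorithm produces a random sequence $X(t)\in S$, $t=1,2,\dots$. Let $(X_i(t))_{t\ge1}$, $i=1,2,\dots$, be independent replications (i.i.d. copies of this process), and let $Y_i(t)=\min\{f(X_i(s)): s=1,\dots,t\}$ be the best value found by replication $i$ until time $t$. The failure probability is $p(t)=\mathbb{P}(Y_i(t)>f_m)$ (the same for all $i$). Let $g(t)=\left[(1-p(t)^{1/t})\,p(t)\right]^{-1}$ for $t=1,2,\dots$, with value $+\infty$ when the bracket is $0$. Assumptions. (1) $p(t)\to 0$ as $t\to\infty$; (2) $g$ admits only one point of minimum $t_m$ and $g$ is strictly decreasing for $t\le t_m$; (3) $p(1)<1$. Restart procedure. Fix positive integers $r_0,T_0$, a number $\lambda\in(0,1)$, and functions $f_r,f_T$ from positive integers to positive integers with $f_r(x)>x$ and $f_T(x)>x$ for all $x$. Given $(r_k,T_k)$, define $$\tilde Y_k=\min\{Y_i(t): 1\le i\le r_k,\ 1\le t\le T_k\},$$ $$\hat p_k(t)=\frac1{r_k}\sum_{i=1}^{r_k}1_{\{Y_i(t)>\tilde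 Y_k\}}\ \text{ for } t=1,\dots,T_k,\qquad \hat p_k(t)=0 \text{ otherwise},$$ and $g_k(t)=\left[(1-\hat p_k(t)^{1/t})\,\hat p_k(t)\right]^{-1}$ for $t=1,\dots,T_k$, with value $+\infty$ when the bracket is $0$. Let $\hat\sigma_k$ be the first relative minimum position of $g_k$, i.e. the smallest $t\in\{1,\dots,T_k\}$ such that $g_k(t)\le g_k(t-1)$ (required only if $t>1$) and $g_k(t)\le g_k(t+1)$ (required only if $t<T_k$). Then $$(r_{k+1},T_{k+1})=\begin{cases}(f_r(r_k),T_k) & \text{if } \hat\sigma_k<\lambda T_k,\\ (r_k,f_T(T_k)) & \text{otherwise.}\end{cases}$$ *)

(* Defs.v *)
From HB Require Import structures.
From mathcomp Require Export all_boot all_order all_algebra.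
From mathcomp Require Export all_classical all_reals all_analysis.

Set Implicit Arguments.
Unset Strict Implicit.
Unset Printing Implicit Defensive.
Import Order.TTheory GRing.Theory Num.Theory.
Import numFieldNormedType.Exports.

Local Open Scope classical_set_scope.
Local Open Scope ring_scope.

(* Conventions.  A trajectory of the algorithm is a function x : nat -> S, of
   which only the values x 1, x 2, ... are used: times start at 1 and x 0 never
   plays any role.  The replications X 0, X 1, ... are numbered from 0, so that
   the first r of them are the X i with i < r. *)

Definition trajectory_cylinders (S : Type) : set (set (nat -> S)) :=
  [set B | exists t : nat, exists s : S,
     (0 < t)%N /\ B = [set x : nat -> S | x t = s]].

(* For countable S, the product sigma-algebra of the discrete one on S. *)
Definition trajectory_measurable (S : Type) : set (set (nat -> S)) :=
  <<s @trajectory_cylinders S >>.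

Definition random_trajectory (d : measure_display) (Omega : measurableType d)
    (S : Type) (Z : Omega -> nat -> S) : Prop :=
  forall B, trajectory_measurable B -> measurable (Z @^-1` B).

Definition independent_trajectories (R : realType) (d : measure_display)
    (Omega : measurableType d) (P : probability Omega R) (S : Type)
    (X : nat -> Omega -> nat -> S) : Prop :=
  forall (J : seq nat) (B : nat -> set (nat -> S)), uniq J ->
    (forall i, i \in J -> trajectory_measurable (B i)) ->
    P (\bigcap_(i in [set` J]) (X i @^-1` B i)) =
    (\prod_(i <- J) P (X i @^-1` B i))%E.

Definition same_law_trajectories (R : realType) (d : measure_display)
    (Omega : measurableType d) (P : probability Omega R) (S : Type)
    (X : nat -> Omega -> nat -> S) : Prop :=
  forall (i j : nat) (B : set (nat -> S)), trajectory_measurable B ->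
    P (X i @^-1` B) = P (X j @^-1` B).

Definition iid_replications (R : realType) (d : measure_display)
    (Omega : measurableType d) (P : probability Omega R) (S : Type)
    (X : nat -> Omega -> nat -> S) : Prop :=
  [/\ forall i, random_trajectory (X i),
      independent_trajectories P X & same_law_trajectories P X].

Definition is_min_value (R : realType) (S : Type) (f : S -> R) (m : R) : Prop :=
  (exists x, f x = m) /\ forall x, m <= f x.

(* The default value of the iterated minimum is one of its terms (t > 0). *)
Definition best (R : realType) (S : Type) (f : S -> R) (x : nat -> S)
    (t : nat) : R :=
  \big[Num.min/f (x 1%N)]_(1 <= s < t.+1) f (x s).

Definition failure_prob (R : realType) (d : measure_display)
    (Omega : measurableType d) (P : probability Omega R) (S : Type)
    (f : S -> R) (fm : R) (Z : Omega -> nat -> S) (t : nat) : R :=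
  fine (P [set w | fm < best f (Z w) t]).

(* The inverse is the one of extended reals, for which 0^-1 = +oo. *)
Definition gfun (R : realType) (q : nat -> R) (t : nat) : \bar R :=
  (((1 - q t `^ (t%:R)^-1) * q t)%:E)^-1%E.

Definition is_min_point (R : realType) (g : nat -> \bar R) (t : nat) : Prop :=
  (0 < t)%N /\ forall s, (0 < s)%N -> (g t <= g s)%E.

Definition rel_min (R : realType) (g : nat -> \bar R) (T t : nat) : bool :=
  ((1 < t)%N ==> (g t <= g t.-1)%E) && ((t < T)%N ==> (g t <= g t.+1)%E).

(* For T > 0 the list is nonempty, as a minimum point of g over {1, ..., T} is a
   relative minimum; the default 0 is then not used. *)
Definition first_rel_min (R : realType) (g : nat -> \bar R) (T : nat) : nat :=
  head 0%N [seq t <- iota 1 T | rel_min g T t].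

(* Again, for r, T > 0 the default value is one of the terms. *)
Definition best_overall (R : realType) (S : Type) (f : S -> R)
    (x : nat -> nat -> S) (r T : nat) : R :=
  \big[Num.min/best f (x 0%N) 1]_(i < r)
    \big[Num.min/best f (x 0%N) 1]_(1 <= t < T.+1) best f (x i) t.

Definition phat (R : realType) (S : Type) (f : S -> R)
    (x : nat -> nat -> S) (r T t : nat) : R :=
  if (1 <= t <= T)%N then
    r%:R^-1 * \sum_(i < r) ((best_overall f x r T < best f (x i) t)%R)%:R
  else 0.

Definition sigma_hat (R : realType) (S : Type) (f : S -> R)
    (x : nat -> nat -> S) (r T : nat) : nat :=
  first_rel_min (gfun (phat f x r T)) T.

Fixpoint restart (R : realType) (S : Type) (f : S -> R)
    (x : nat -> nat -> S) (lam : R) (fr fT : nat -> nat) (r0 T0 : nat)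
    (k : nat) : nat * nat :=
  if k is k'.+1 then
    let: (r, T) := restart f x lam fr fT r0 T0 k' in
    if (sigma_hat f x r T)%:R < lam * T%:R then (fr r, T) else (r, fT T)
  else (r0, T0).

Definition phat_at (R : realType) (S : Type) (f : S -> R)
    (x : nat -> nat -> S) (lam : R) (fr fT : nat -> nat) (r0 T0 k t : nat) : R :=
  let: (r, T) := restart f x lam fr fT r0 T0 k in phat f x r T t.

Definition sigma_hat_at (R : realType) (S : Type) (f : S -> R)
    (x : nat -> nat -> S) (lam : R) (fr fT : nat -> nat) (r0 T0 k : nat) : nat :=
  let: (r, T) := restart f x lam fr fT r0 T0 k in sigma_hat f x r T.

(* Main.v *)
From HB Require Import structures.
Require Import Defs.
From mathcomp Require Import measurable_realfun zify ring lra.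
Set Implicit Arguments.
Unset Strict Implicit.
Unset Printing Implicit Defensive.
Import Order.TTheory GRing.Theory Num.Theory.
Import numFieldNormedType.Exports.
Local Open Scope classical_set_scope.
Local Open Scope ring_scope.

(* Almost surely, (A) for every t >= 1 the frequency of failures at time t
   among the first n replications tends to p(t) (strong law of large numbers),
   and (B) every replication reaches the minimum of f, as p(t) tends to 0.  The
   rest is deterministic.  Comparing values of g amounts to comparing the
   brackets (1 - q^(1/t)) q in reverse order, and these depend continuously on
   q; hence, by (A), the first relative minimum is min(t_m, T) once r is large.
   If r stopped growing, T would tend to infinity, and by (B) the estimated
   failure probabilities would vanish from some fixed time on, which bounds the
   first relative minimum and forces r to grow.  If T stayed below
   ceil(t_m / lambda), the first relative minimum min(t_m, T) would be at least
   lambda T for large r, which forces T to grow. *)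

(** * Order and continuity of the bracket $(1-q^{1/t})q$ *)

(** With $0^{-1}=+\infty$ the inverse still reverses the order at 0, so comparisons of [gfun] become
    comparisons of real brackets. *)
Lemma le_inveE (R : realType) (a b : R) : 0 <= a -> 0 <= b ->
  ((a%:E)^-1 <= (b%:E)^-1)%E = (b <= a).
Proof.
move=> a0 b0; rewrite !inver.
have [->|an0] := eqVneq a 0; have [->|bn0] := eqVneq b 0; rewrite ?lexx ?leey //.
- by rewrite leye_eq /=; apply/esym/negbTE; rewrite -ltNge lt_neqAle eq_sym bn0.
- by rewrite lee_fin lef_pV2 // posrE lt_neqAle eq_sym ?an0 ?bn0.
Qed.

Definition bracket (R : realType) (q : R) (t : nat) : R :=
  (1 - q `^ (t%:R)^-1) * q.

Lemma gfunE (R : realType) (q : nat -> R) (t : nat) :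
  gfun q t = ((bracket (q t) t)%:E)^-1%E.
Proof. by []. Qed.

Lemma bracket_ge0 (R : realType) (q : R) (t : nat) :
  0 <= q <= 1 -> 0 <= bracket q t.
Proof.
move=> /andP[q0 q1]; rewrite mulr_ge0 // subr_ge0.
rewrite -[leRHS]((congr1 (@^~ (t%:R^-1)) (@powR1 R))).
by apply: ge0_ler_powR; rewrite ?nnegrE ?invr_ge0 ?ler01.
Qed.

(** At $q>0$ the power function is differentiable, hence continuous. At $q=0$ differentiability may
    fail, and monotonicity is used instead: $u_n<e^t$ gives $u_n^{1/t}\le e$. *)
Lemma cvg_powR_root (R : realType) (u : nat -> R) (q : R) (t : nat) :
  (0 < t)%N -> (forall n, 0 <= u n) -> u n @[n --> \oo] --> q ->
  u n `^ (t%:R)^-1 @[n --> \oo] --> q `^ (t%:R)^-1.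
Proof.
move=> t0 u0 uq.
have q0 : 0 <= q.
  by rewrite -(cvg_lim _ uq) //; apply: limr_ge; [apply: cvgP uq|near=> n].
have t0' : 0 < (t%:R^-1 : R) by rewrite invr_gt0 ltr0n.
have [q_eq0|qn0] := eqVneq q 0.
  rewrite q_eq0 powR0 ?gt_eqF //; apply/cvgrPdist_le => e e0.
  have et : 0 < e `^ t%:R by rewrite powR_gt0.
  near=> n.
  rewrite sub0r normrN ger0_norm ?powR_ge0 //.
  have -> : e = (e `^ t%:R) `^ (t%:R)^-1.
    by rewrite -powRrM divff ?powRr1 ?ltW // pnatr_eq0 -lt0n.
  apply: ge0_ler_powR; rewrite ?nnegrE ?powR_ge0 ?u0 ?ltW //.
  rewrite -[X in X < _]ger0_norm ?u0 // -normrN -sub0r -q_eq0.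
  by near: n; exact: (@cvgr_dist_lt _ _ _ _ _ _ _ uq _ et).
have qp : 0 < q by rewrite lt_neqAle eq_sym qn0.
have cq : {for q, continuous (fun a : R => a `^ (t%:R)^-1)}.
  apply/differentiable_continuous/derivable1_diffP.
  by apply: derivable_powR; rewrite in_itv /= qp.
exact: (cvg_comp u (fun a => a `^ (t%:R)^-1) uq cq).
Unshelve. all: by end_near. Qed.

Lemma cvg_bracket (R : realType) (u : nat -> R) (q : R) (t : nat) :
  (0 < t)%N -> (forall n, 0 <= u n) -> u n @[n --> \oo] --> q ->
  bracket (u n) t @[n --> \oo] --> bracket q t.
Proof.
move=> t0 u0 uq; apply: cvgM => //; apply: cvgB; first exact: cvg_cst.
exact: cvg_powR_root.
Qed.

(** * First relative minima, best values and failure frequencies *)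

(** A relative minimum [t] makes the filtered list nonempty, so its head is not the default 0; the
    list being sorted, the head is at most [t]. *)
Lemma first_rel_min_le (R : realType) (g : nat -> \bar R) (T t : nat) :
  (0 < t <= T)%N -> rel_min g T t ->
  (first_rel_min g T <= t)%N /\
  (0 < first_rel_min g T <= T)%N /\ rel_min g T (first_rel_min g T).
Proof.
move=> tT gt; rewrite /first_rel_min.
have : t \in [seq t <- iota 1 T | rel_min g T t].
  by rewrite mem_filter gt mem_iota add1n ltnS.
have : sorted ltn [seq t <- iota 1 T | rel_min g T t].
  by apply: sorted_filter; [exact: ltn_trans|exact: iota_ltn_sorted].
have : all (fun t => (0 < t <= T)%N && rel_min g T t) [seq t <- iota 1 T | rel_min g T t].
  by apply/allP => s; rewrite mem_filter mem_iota add1n ltnS => /andP[-> ->].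
case: [seq t <- iota 1 T | rel_min g T t] => // a s /= /andP[/andP[-> ->] _] ps.
rewrite inE => /orP[/eqP -> //|ts]; split => //.
by have /allP/(_ _ ts) := order_path_min ltn_trans ps; exact: ltnW.
Qed.

Lemma best_nonincreasing (R : realType) (S : Type) (f : S -> R) (x : nat -> S) (s t : nat) :
  (s <= t)%N -> best f x t <= best f x s.
Proof. by move=> st; apply: le_bigmin_nat. Qed.

Lemma best_ge (R : realType) (S : Type) (f : S -> R) (fm : R) (x : nat -> S) (t : nat) :
  (forall s, fm <= f s) -> fm <= best f x t.
Proof. by move=> fmP; apply: le_bigmin. Qed.

Lemma best_overall_ge (R : realType) (S : Type) (f : S -> R) (fm : R)
    (x : nat -> nat -> S) (r T : nat) :
  (forall s, fm <= f s) -> fm <= best_overall f x r T.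
Proof.
move=> fmP; apply: le_bigmin => [|i _]; first exact: best_ge.
by apply: le_bigmin => [|t _]; exact: best_ge.
Qed.

Lemma best_overall_le (R : realType) (S : Type) (f : S -> R)
    (x : nat -> nat -> S) (r T i t : nat) :
  (i < r)%N -> (0 < t <= T)%N -> best_overall f x r T <= best f (x i) t.
Proof.
move=> ir tT; apply: le_trans (bigmin_le _ (Ordinal ir) _) _ => /=.
(* The minimum over all times is at most the one over the single time [t]. *)
apply: (@le_trans _ _ (\big[Num.min/best f (x 0%N) 1]_(t <= s < t.+1) best f (x i) s)).
  by apply: le_bigmin_nat; case/andP: tT.
by rewrite big_nat1_id ge_min lexx.
Qed.

Lemma near_cvg_lt (R : realType) (u v : nat -> R) (a b : R) :
  u n @[n --> \oo] --> a -> v n @[n --> \oo] --> b -> a < b ->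
  \forall n \near \oo, u n < v n.
Proof.
move=> ua vb ab; near=> n; apply: (@lt_trans _ _ ((a + b) / 2)).
  by near: n; apply: (cvgr_lt _ ua); rewrite midf_lt.
by near: n; apply: (cvgr_gt _ vb); rewrite midf_lt.
Unshelve. all: by end_near. Qed.

(** This is [phat] with the estimated minimum replaced by the true one: an empirical mean of i.i.d.
    indicators, to which a law of large numbers applies. *)
Definition fail_freq (R : realType) (S : Type) (f : S -> R) (fm : R)
    (x : nat -> nat -> S) (t n : nat) : R :=
  n%:R^-1 * \sum_(i < n) ((fm < best f (x i) t)%R)%:R.

Lemma fail_freq_itv (R : realType) (S : Type) (f : S -> R) (fm : R)
    (x : nat -> nat -> S) (t n : nat) : 0 <= fail_freq f fm x t n <= 1.
Proof.
rewrite /fail_freq; case: n => [|n]; first by rewrite big_ord0 mulr0 lexx ler01.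
rewrite mulr_ge0 ?sumr_ge0 //= mulrC ler_pdivrMr ?ltr0n // mul1r.
apply: (@le_trans _ _ (\sum_(i < n.+1) 1)).
  by apply: ler_sum => i _; rewrite lern1 leq_b1.
by rewrite sumr_const card_ord.
Qed.

(** One hit of [fm] among the first [r] replications up to time [T] forces the overall best value to
    be [fm]. *)
Lemma phat_fail_freq (R : realType) (S : Type) (f : S -> R) (fm : R)
    (x : nat -> nat -> S) (r T t i s : nat) : (forall y, fm <= f y) ->
  (i < r)%N -> (0 < s <= T)%N -> best f (x i) s = fm ->
  (0 < t <= T)%N -> phat f x r T t = fail_freq f fm x t r.
Proof.
move=> fmP ir sT hit tT; rewrite /phat tT /fail_freq.
suff -> : best_overall f x r T = fm by [].
apply/eqP; rewrite eq_le best_overall_ge // andbT -hit.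
exact: best_overall_le.
Qed.

(** * The first relative minimum along fixed trajectories, for many replications *)

Section FixedTrajectories.
Context (R : realType) (S : Type) (f : S -> R) (fm : R).
Context (fmP : forall y, fm <= f y) (x : nat -> nat -> S) (p : nat -> R).
Context (freq_cvg : forall t, (0 < t)%N ->
  fail_freq f fm x t n @[n --> \oo] --> p t).
Context (hits : forall i, exists2 t, (0 < t)%N & best f (x i) t = fm).
Context (p1_lt1 : p 1%N < 1).
Context (tm : nat) (tm_min : is_min_point (gfun p) tm).
Context (tm_uniq : forall t, is_min_point (gfun p) t -> t = tm).
Context (g_decr : forall s t, (0 < s)%N -> (s < t)%N -> (t <= tm)%N ->
  (gfun p t < gfun p s)%E).

Local Notation freq := (fail_freq f fm x).

Let tm_gt0 : (0 < tm)%N. Proof. by case: tm_min. Qed.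

Lemma limit_itv t : (0 < t)%N -> 0 <= p t <= 1.
Proof.
move=> t0; have pt := freq_cvg t0; apply/andP; split.
  rewrite -(cvg_lim _ pt) //; apply: limr_ge; first exact: cvgP pt.
  by near=> n; case/andP: (fail_freq_itv f fm x t n).
rewrite -(cvg_lim _ pt) //; apply: limr_le; first exact: cvgP pt.
by near=> n; case/andP: (fail_freq_itv f fm x t n).
Unshelve. all: by end_near. Qed.

(** Otherwise the failure frequency at time 1 would be 1 for all $n\ge1$, against its limit
    $p(1)<1$. A hit at time 1 serves every horizon $T\ge1$. *)
Lemma hit_at1 : exists i, best f (x i) 1 = fm.
Proof.
apply: contrapT => /forallNP nohit.
have : \forall n \near \oo, freq 1 n < 1 by apply: (cvgr_lt _ (freq_cvg _)).
move=> [n _ /(_ n.+1 (leqnSn n))] /=.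
rewrite /fail_freq (eq_bigr (fun=> 1)) => [|i _].
  by rewrite sumr_const card_ord mulVf ?pnatr_eq0 // ltxx.
by rewrite lt_neqAle best_ge // andbT eq_sym; have /eqP/negbTE -> := nohit i.
Qed.

Lemma bracket_lt s t : (0 < s)%N -> (0 < t)%N -> (gfun p t < gfun p s)%E ->
  bracket (p s) s < bracket (p t) t.
Proof.
move=> s0 t0; rewrite ltNge (gfunE p s) (gfunE p t) le_inveE -?ltNge //.
  exact: bracket_ge0 (limit_itv s0).
exact: bracket_ge0 (limit_itv t0).
Qed.

Lemma gfun_tm_lt t : (0 < t)%N -> t != tm -> (gfun p tm < gfun p t)%E.
Proof.
move=> t0; apply: contraNT; rewrite -leNgt => gt; apply/eqP/tm_uniq; split => //.
by move=> s s0; apply: le_trans gt _; exact: (proj2 tm_min).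
Qed.

Lemma cvg_bracket_freq t : (0 < t)%N ->
  bracket (freq t n) t @[n --> \oo] --> bracket (p t) t.
Proof.
move=> t0; apply: cvg_bracket (freq_cvg _) => // n.
by case/andP: (fail_freq_itv f fm x t n).
Qed.

(** Finitely many strict inequalities decide: the brackets increase up to [tm] and drop right after
    it. They pass from [p] to the frequencies for large [r], and they do not involve [T]; hence the
    uniformity in [T]. *)
Lemma sigma_hat_minn :
  \forall r \near \oo, forall T, (0 < T)%N -> sigma_hat f x r T = minn tm T.
Proof.
have [i0 hit] := hit_at1.
have incr : \forall r \near \oo, forall t : 'I_tm, (0 < t)%N ->
    bracket (freq t r) t < bracket (freq t.+1 r) t.+1.
  apply: filter_forall => t; have [->|t0] := posnP t; first by near=> r.
  have := near_cvg_lt (cvg_bracket_freq t0) (@cvg_bracket_freq t.+1 isT).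
  have /bracket_lt lt_t := g_decr t0 (ltnSn t) (ltn_ord t).
  by move=> /(_ (lt_t t0 isT)); apply: filterS => r.
(* The drop after [tm] comes from the uniqueness of the minimum point. *)
have decr : \forall r \near \oo,
    bracket (freq tm.+1 r) tm.+1 < bracket (freq tm r) tm.
  apply: near_cvg_lt (cvg_bracket_freq _) (cvg_bracket_freq tm_gt0) _ => //.
  by apply: bracket_lt => //; apply: gfun_tm_lt => //; rewrite eqn_leq ltnn.
near=> r => T T0.
have i0r : (i0 < r)%N by near: r; exact: nbhs_infty_gt.
have incr_r : forall t : 'I_tm, (0 < t)%N ->
    bracket (freq t r) t < bracket (freq t.+1 r) t.+1 by near: r.
have decr_r : bracket (freq tm.+1 r) tm.+1 < bracket (freq tm r) tm by near: r.
have phatE t : (0 < t <= T)%N -> phat f x r T t = freq t r.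
  by move=> tT; apply: phat_fail_freq hit tT.
rewrite /sigma_hat; set g := gfun _.
have gle s t : (0 < s <= T)%N -> (0 < t <= T)%N ->
    (g s <= g t)%E = (bracket (freq t r) t <= bracket (freq s r) s).
  move=> sT tT; rewrite /g !gfunE !phatE // le_inveE //;
    by apply: bracket_ge0; exact: fail_freq_itv.
have mT : (0 < minn tm T <= T)%N by rewrite leq_min tm_gt0 T0 geq_minr.
have relm : rel_min g T (minn tm T).
  apply/andP; split; apply/implyP => h.
    rewrite gle; [|lia..].
    have h' : ((minn tm T).-1 < tm)%N by lia.
    have p0 : (0 < (minn tm T).-1)%N by lia.
    by have := incr_r (Ordinal h') p0; rewrite /= prednK; [exact: ltW|lia].
  have -> : minn tm T = tm by lia.
  by rewrite gle ?ltW //; lia.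
have [le1 [/andP[s0 sT] /andP[_ rels]]] := first_rel_min_le mT relm.
(* A relative minimum before [minn tm T] would contradict the strict increase of the brackets
   there. *)
apply/eqP; rewrite eqn_leq le1 leqNgt; apply/negP => lt1.
have h' : (first_rel_min g T < tm)%N by lia.
have := incr_r (Ordinal h') s0; rewrite ltNge /= -gle ?s0 //; [|lia..].
by move/negP; apply; apply: (implyP rels); lia.
Unshelve. all: by end_near. Qed.

End FixedTrajectories.

(** * Growth of the two parameters of the restart, for an abstract test [c] *)

Section GrowthOfRestart.
Local Open Scope nat_scope.
Context (c : nat -> nat -> bool) (fr fT : nat -> nat) (rk Tk : nat -> nat).
Context (fr_gt : forall n, 0 < n -> n < fr n) (fT_gt : forall n, 0 < n -> n < fT n).
Context (rk0 : 0 < rk 0) (Tk0 : 0 < Tk 0).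
Context (rkS : forall k, rk k.+1 = if c (rk k) (Tk k) then fr (rk k) else rk k).
Context (TkS : forall k, Tk k.+1 = if c (rk k) (Tk k) then Tk k else fT (Tk k)).

Lemma rk_Tk_gt0 k : (0 < rk k) && (0 < Tk k).
Proof.
elim: k => [|k /andP[rk_gt0 Tk_gt0]]; first by rewrite rk0 Tk0.
rewrite rkS TkS; case: ifP => _.
  by rewrite (ltn_trans rk_gt0) ?fr_gt.
by rewrite rk_gt0 (ltn_trans Tk_gt0) ?fT_gt.
Qed.

Let rk_gt0 k : 0 < rk k. Proof. by case/andP: (rk_Tk_gt0 k). Qed.
Let Tk_gt0 k : 0 < Tk k. Proof. by case/andP: (rk_Tk_gt0 k). Qed.

Lemma rk_homo : {homo rk : m n / m <= n}.
Proof.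
apply: homo_leq => [//|m n p|k]; first exact: leq_trans.
by rewrite rkS; case: ifP => // _; rewrite ltnW // fr_gt.
Qed.

Lemma Tk_homo : {homo Tk : m n / m <= n}.
Proof.
apply: homo_leq => [//|m n p|k]; first exact: leq_trans.
by rewrite TkS; case: ifP => // _; rewrite ltnW // fT_gt.
Qed.

(** If the test failed at every step from [k] on, [r] would stay fixed while [T] grows by at least 1
    each time; but for fixed [r] the test succeeds for all large [T]. *)
Lemma rk_unbounded :
  (forall r, 0 < r -> \forall T \near \oo, c r T) -> forall N, \forall k \near \oo, N <= rk k.
Proof.
move=> c_near N; suff [k Nk] : exists k, N <= rk k.
  by exists k => // k' /= kk'; apply: leq_trans Nk _; exact: rk_homo.
elim: N => [|N [k Nk]]; first by exists 0.
have [[k' kk' ck']|/forall2NP noc] := pselect (exists2 k', k <= k' & c (rk k') (Tk k')).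
  exists k'.+1; rewrite rkS ck'; apply: leq_ltn_trans (fr_gt _) => //.
  exact: leq_trans (rk_homo kk').
have ck j : c (rk (k + j)) (Tk (k + j)) = false.
  by apply/negP; case: (noc (k + j)) => // /negP; rewrite leq_addr.
have rkj j : rk (k + j) = rk k.
  by elim: j => [|j IH]; rewrite ?addn0 // addnS rkS ck.
have Tkj j : j <= Tk (k + j).
  elim: j => [//|j IH]; rewrite addnS TkS ck.
  by apply: leq_ltn_trans IH _; exact: fT_gt.
have [T0 _ cT0] := c_near _ (rk_gt0 k).
by have := cT0 (Tk (k + T0)) (Tkj T0); rewrite -(rkj T0) /= ck.
Qed.

(** If the test succeeded at every step from [k] on, [T] would stay fixed below [M] while [r] tends
    to infinity; but for large [r] the test fails at every such [T]. *)
Lemma Tk_large M : (forall N, \forall k \near \oo, N <= rk k) ->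
  (\forall r \near \oo, forall T, 0 < T < M -> ~~ c r T) ->
  \forall k \near \oo, M <= Tk k.
Proof.
move=> rk_oo [R0 _ nc]; suff [k Mk] : exists k, M <= Tk k.
  by exists k => // k' /= kk'; apply: leq_trans Mk _; exact: Tk_homo.
(* Growth of [T] is forced only below [M], so the induction is capped there. *)
suff : forall N, exists k, minn N M <= Tk k by move=> /(_ M); rewrite minnn.
elim=> [|N [k Nk]]; first by exists 0; rewrite min0n.
have [MT|TM] := leqP M (Tk k); first by exists k; lia.
have [[k' kk' ck']|/forall2NP allc] := pselect (exists2 k', k <= k' & ~~ c (rk k') (Tk k')).
  exists k'.+1; rewrite TkS (negbTE ck').
  by have := fT_gt (Tk_gt0 k'); have := Tk_homo kk'; lia.
have ck j : c (rk (k + j)) (Tk (k + j)).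
  by apply/negPn/negP; case: (allc (k + j)) => // /negP; rewrite leq_addr.
have Tkj j : Tk (k + j) = Tk k.
  by elim: j => [|j IH]; rewrite ?addn0 // addnS TkS ck.
have [k1 _ k1P] := rk_oo R0.
have := nc (rk (k + k1)) (k1P _ (leq_addl _ _)) (Tk k).
by rewrite TM Tk_gt0 => /(_ isT); rewrite -(Tkj k1) ck.
Qed.

End GrowthOfRestart.

(** * Deterministic convergence of the restart procedure *)

Lemma ltn_absz_ceil (R : archiRealDomainType) (n : nat) (y : R) :
  0 <= y -> (n < `|Num.ceil y|)%N = (n%:R < y).
Proof.
move=> y0; rewrite -ltz_nat gez0_abs ?ltNge ?ceil_le_int //.
by rewrite ceil_ge0 (lt_le_trans _ y0) // ltrN10.
Qed.

Section RestartConvergence.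
Context (R : realType) (S : Type) (f : S -> R) (fm : R).
Context (fmP : forall y, fm <= f y) (x : nat -> nat -> S) (p : nat -> R).
Context (freq_cvg : forall t, (0 < t)%N ->
  fail_freq f fm x t n @[n --> \oo] --> p t).
Context (hits : forall i, exists2 t, (0 < t)%N & best f (x i) t = fm).
Context (p1_lt1 : p 1%N < 1).
Context (tm : nat) (tm_min : is_min_point (gfun p) tm).
Context (tm_uniq : forall t, is_min_point (gfun p) t -> t = tm).
Context (g_decr : forall s t, (0 < s)%N -> (s < t)%N -> (t <= tm)%N ->
  (gfun p t < gfun p s)%E).
Context (lam : R) (lam_gt0 : 0 < lam) (lam_lt1 : lam < 1).

(** Let [ts] be a time by which the first [r] replications have all hit the minimum. From [ts] on
    the estimate is 0 and its [gfun] is $+\infty$, whatever the horizon. *)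
Lemma sigma_hat_bounded r : (0 < r)%N ->
  exists s, \forall T \near \oo, (sigma_hat f x r T <= s)%N.
Proof.
move=> r0; have /choice[h hP] i : exists t, (0 < t)%N /\ best f (x i) t = fm.
  by have [t ? ?] := hits i; exists t.
pose ts := \max_(i < r) h i.
have hit (i : 'I_r) t : (ts <= t)%N -> best f (x i) t = fm.
  move=> tst; apply/eqP; rewrite eq_le best_ge // andbT -(proj2 (hP i)).
  by apply: best_nonincreasing; apply: leq_trans tst; exact: (leq_bigmax i).
have ts0 : (0 < ts)%N.
  by apply: leq_trans (proj1 (hP (Ordinal r0))) _; exact: (leq_bigmax (Ordinal r0)).
(* At [ts] itself the preceding value may be finite; at [ts.+1] both neighbours are infinite, so
   this is a relative minimum. *)
exists ts.+1; near=> T.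
have tsT : (ts < T)%N by near: T; exact: nbhs_infty_gt.
have goo t : (ts <= t <= T)%N -> gfun (phat f x r T) t = +oo%E.
  move=> /andP[tst tT]; rewrite gfunE /bracket.
  rewrite (@phat_fail_freq _ _ _ fm _ _ _ _ 0%N ts) // ?ts0 ?(ltnW tsT) //.
  - rewrite /fail_freq big1 ?mulr0 ?inve0 // => i _.
    by rewrite hit // ltxx.
  - exact: (hit (Ordinal r0)).
  - by rewrite tT (leq_trans ts0).
have [//||//] := @first_rel_min_le _ (gfun (phat f x r T)) T ts.+1.
by apply/andP; split; apply/implyP => /= ?; rewrite !goo //; lia.
Unshelve. all: by end_near. Qed.

Lemma sigma_hat_lt_near r : (0 < r)%N ->
  \forall T \near \oo, (sigma_hat f x r T)%:R < lam * T%:R.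
Proof.
move=> r0; have [s sP] := sigma_hat_bounded r0.
near=> T; apply: (@le_lt_trans _ _ s%:R); first by rewrite ler_nat; near: T.
by rewrite mulrC -ltr_pdivrMr //; near: T; exact: nbhs_infty_gtr.
Unshelve. all: by end_near. Qed.

Lemma restart_cvg (fr fT : nat -> nat) (r0 T0 : nat) :
  (0 < r0)%N -> (0 < T0)%N ->
  (forall n, (0 < n)%N -> (n < fr n)%N) -> (forall n, (0 < n)%N -> (n < fT n)%N) ->
  (forall t, (1 <= t <= `|Num.ceil (tm%:R / lam)|)%N ->
     phat_at f x lam fr fT r0 T0 k t @[k --> \oo] --> p t) /\
  ((sigma_hat_at f x lam fr fT r0 T0 k)%:R : R) @[k --> \oo] --> (tm%:R : R).
Proof.
move=> r0_gt0 T0_gt0 fr_gt fT_gt; set M := `|Num.ceil _|%N.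
have tm_gt0 : (0 < tm)%N by case: tm_min.
pose rk k := (restart f x lam fr fT r0 T0 k).1.
pose Tk k := (restart f x lam fr fT r0 T0 k).2.
pose c r T := (sigma_hat f x r T)%:R < lam * T%:R.
have rkS k : rk k.+1 = if c (rk k) (Tk k) then fr (rk k) else rk k.
  by rewrite /rk /Tk /c /=; case: (restart _ _ _ _ _ _ _ k) => r T /=; case: ifP.
have TkS k : Tk k.+1 = if c (rk k) (Tk k) then Tk k else fT (Tk k).
  by rewrite /rk /Tk /c /=; case: (restart _ _ _ _ _ _ _ k) => r T /=; case: ifP.
have MP T : (T < M)%N = (T%:R < tm%:R / lam).
  by apply: ltn_absz_ceil; rewrite divr_ge0 // ltW.
have ltM T : (T < M)%N -> lam * T%:R < tm%:R by rewrite MP ltr_pdivlMr // mulrC.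
(* Since $\lambda<1$, a horizon of at least [M] contains [tm]. *)
have tmM : (tm < M)%N by rewrite MP ltr_pdivlMr // gtr_pMr // ltr0n.
have rk_oo : forall N, \forall k \near \oo, (N <= rk k)%N.
  apply: (@rk_unbounded c fr fT rk Tk) => // r rp.
  exact: sigma_hat_lt_near.
have sigma_near := sigma_hat_minn fmP freq_cvg p1_lt1 tm_min tm_uniq g_decr.
have Tk_M : \forall k \near \oo, (M <= Tk k)%N.
  apply: (@Tk_large c fr fT rk Tk) => //.
  apply: filterS sigma_near => r rP T /andP[Tp TM].
  (* If $t_m\le T<M$ the first relative minimum is $t_m>\lambda T$; if $T<t_m$ it is $T\ge\lambda
     T$. The test fails in both cases. *)
  rewrite /c rP // -leNgt; have [tmT|Ttm] := leqP tm T; first exact/ltW/ltM.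
  by rewrite ler_piMl // ltW.
have rk_cvg : rk k @[k --> \oo] --> \oo by apply/cvgnyPge.
have [i0 hit] := hit_at1 fmP freq_cvg p1_lt1.
split => [t /andP[t1 tM]|].
  apply: cvg_trans (cvg_comp rk _ rk_cvg (freq_cvg t1)).
  apply: near_eq_cvg; near=> k.
  rewrite /phat_at /= -(@phat_fail_freq _ _ f fm x (rk k) (Tk k) t i0 1) //.
  - by rewrite /rk /Tk; case: restart.
  - by near: k; exact: rk_oo.
  - by rewrite /=; apply: leq_trans t1 (leq_trans tM _); near: k.
  - by rewrite t1 (leq_trans tM) //; near: k.
apply: cvg_near_cst; near=> k.
have -> : sigma_hat_at f x lam fr fT r0 T0 k = sigma_hat f x (rk k) (Tk k).
  by rewrite /sigma_hat_at /rk /Tk; case: restart.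
have MT : (M <= Tk k)%N by near: k.
(* As [rk k] and [Tk k] vary together, the uniformity in [T] of [sigma_near] is essential. *)
have -> : sigma_hat f x (rk k) (Tk k) = minn tm (Tk k).
  have T0' : (0 < Tk k)%N by lia.
  by move: (Tk k) T0'; near: k; exact: (rk_cvg _ sigma_near).
by rewrite (minn_idPl _) // ltnW // (leq_trans tmM).
Unshelve. all: by end_near. Qed.

End RestartConvergence.

(** * A strong law of large numbers for pairwise independent events of equal probability *)

Lemma integral_affine_indic (R : realType) (d : measure_display)
    (Omega : measurableType d) (P : probability Omega R) (I : Type)
    (s : seq I) (B : I -> set Omega) (b : I -> R) (k c : R) :
  (forall i, measurable (B i)) -> (forall i, P (B i) = (b i)%:E) ->
  0 <= k -> 0 <= c ->
  (\int[P]_w (k * (\sum_(i <- s) \1_(B i) w) + c)%:E =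
   (k * (\sum_(i <- s) b i) + c)%:E)%E.
Proof.
move=> mB PB k0 c0.
have mS : measurable_fun setT (fun w => (\sum_(i <- s) (\1_(B i) w : R))%:E).
  by apply/measurable_EFinP; apply: measurable_sum => i; exact: measurable_indic.
have S0 w : 0 <= \sum_(i <- s) \1_(B i) w :> R by apply: sumr_ge0 => i _.
under eq_integral do rewrite EFinD EFinM.
rewrite ge0_integralD //=.
- rewrite integral_cst //= probability_setT mule1 ge0_integralZl_EFin //=.
  + under eq_integral do rewrite -sumEFin.
    rewrite ge0_integral_sum //=.
    * rewrite EFinD EFinM -sumEFin; congr (_ * _ + _)%E; apply: eq_bigr => i _.
      by rewrite integral_indic //= setIT PB.
    * by move=> i; apply/measurable_EFinP; exact: measurable_indic.
  + by move=> w _; rewrite lee_fin.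
- by move=> w _; rewrite -EFinM lee_fin mulr_ge0.
- by apply: measurable_funeM.
Qed.

(* The square is expanded with the negative term moved to the other side, so
   that only nonnegative functions are integrated. *)
Lemma second_moment_mean (R : realType) (d : measure_display)
    (Omega : measurableType d) (P : probability Omega R)
    (A : nat -> set Omega) (q : R) (N : nat) :
  (forall i, measurable (A i)) -> (forall i, P (A i) = q%:E) ->
  (forall i j, i != j -> P (A i `&` A j) = (q * q)%:E) -> (0 < N)%N ->
  (\int[P]_w ((N%:R^-1 * (\sum_(i < N) \1_(A i) w) - q) ^+ 2)%:E <=
   (N%:R^-1)%:E)%E.
Proof.
move=> mA PA PAA N0.
have q0 : 0 <= q by rewrite -lee_fin -(PA 0%N).
have q1 : q <= 1 by rewrite -lee_fin -(PA 0%N) probability_le1.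
have Ni0 : 0 <= (N%:R^-1 : R) by rewrite invr_ge0.
pose D w := (N%:R^-1 * (\sum_(i < N) \1_(A i) w) - q) ^+ 2.
have mU : measurable_fun setT (fun w => \sum_(i < N) \1_(A i) w : R).
  by apply: measurable_sum => i; exact: measurable_indic.
have mD : measurable_fun setT D.
  by apply: measurable_funX; apply: measurable_funB => //; apply: measurable_funM.
pose U w := (2 * q / N%:R) * (\sum_(i <- index_enum 'I_N) \1_(A i) w) + 0.
have E1 : (\int[P]_w ((D w)%:E + (U w)%:E) =
    (N%:R^-1 ^+ 2 * (N%:R * (q + (N%:R - 1) * (q * q))) + q ^+ 2)%:E)%E.
  transitivity (\int[P]_w (N%:R^-1 ^+ 2 *
      (\sum_(ij : 'I_N * 'I_N) \1_(A ij.1 `&` A ij.2) w) + q ^+ 2)%:E)%E.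
    apply: eq_integral => w _; rewrite -EFinD; congr EFin.
    (* The squared count is a sum over pairs; an intersection has probability [q] on the diagonal
       and $q^2$ off it. *)
    have -> : \sum_(ij : 'I_N * 'I_N) \1_(A ij.1 `&` A ij.2) w =
              (\sum_(i < N) \1_(A i) w) ^+ 2 :> R.
      rewrite expr2 mulr_suml -(pair_bigA _ (fun i j : 'I_N => \1_(A i `&` A j) w)) /=.
      apply: eq_bigr => i _; rewrite mulr_sumr; apply: eq_bigr => j _.
      by rewrite indicI.
    by rewrite /D /U; ring.
  rewrite (@integral_affine_indic _ _ _ _ _ _ _
     (fun ij : 'I_N * 'I_N => if ij.1 == ij.2 then q else q * q)) ?sqr_ge0 ?exprn_ge0 //.
  - congr (_ * _ + _)%:E.
    rewrite -(pair_bigA _ (fun i j : 'I_N => if i == j then q else q * q)) /=.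
    rewrite (eq_bigr (fun=> q + (N%:R - 1) * (q * q))).
      by rewrite sumr_const card_ord mulr_natl.
    move=> i _; rewrite (bigD1 i) //= eqxx; congr (_ + _).
    rewrite (eq_bigr (fun=> q * q)) => [|j]; last by rewrite eq_sym => /negbTE ->.
    by rewrite sumr_const cardC1 card_ord -subn1 mulrBl mul1r mulr_natl mulrnBr.
  - by move=> ij; exact: measurableI.
  - move=> [i j] /=; have [->|ij] := eqVneq i j; first by rewrite setIid.
    exact: PAA.
move: E1; rewrite ge0_integralD //=.
- rewrite [X in (_ + X)%E](@integral_affine_indic _ _ _ _ _ _ _ (fun=> q)) //.
    rewrite sumr_const card_ord => E1.
    rewrite -(@leeD2rE _ (2 * q / N%:R * (q *+ N) + 0)%:E) // E1 -EFinD lee_fin.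
    rewrite -[q *+ N]mulr_natl addr0.
    have Nn0 : (N%:R : R) != 0 by rewrite pnatr_eq0 -lt0n.
    (* The first term on the right is the exact variance $(q-q^2)/N$, at most $1/N$. *)
    have -> : N%:R^-1 ^+ 2 * (N%:R * (q + (N%:R - 1) * (q * q))) + q ^+ 2 =
              N%:R^-1 * (q - q ^+ 2) + 2 * q / N%:R * (N%:R * q) by field.
    rewrite lerD2r ler_piMr //; nra.
  by rewrite !mulr_ge0.
- by move=> w _; rewrite lee_fin sqr_ge0.
- exact/measurable_EFinP.
- move=> w _; rewrite lee_fin /U addr0 mulr_ge0 ?mulr_ge0 //.
  by apply: sumr_ge0 => i _.
- apply/measurable_EFinP/measurable_funD => //.
  by apply: measurable_funM.
Qed.

(** The bound is strengthened to $2-2/(n+1)$ for the induction, as $1/a^2\le 2/a-2/(a+1)$ for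
    $a\ge1$. *)
Lemma sum_inv_squares_le (R : realFieldType) (n : nat) :
  \sum_(0 <= k < n) ((k.+1 ^ 2)%N%:R^-1 : R) <= 2.
Proof.
suff : \sum_(0 <= k < n) ((k.+1 ^ 2)%N%:R^-1 : R) <= 2 - 2 / n.+1%:R.
  by move/le_trans; apply; rewrite lerBlDr lerDl divr_ge0.
elim: n => [|n IH]; first by rewrite big_nil divr1 subrr.
rewrite big_nat_recr //=; apply: (le_trans (lerD IH (lexx _))).
rewrite natrX -[n.+2%:R]natr1; set a : R := n.+1%:R.
have a1 : 1 <= a by rewrite ler1n.
rewrite -subr_ge0.
have -> : 2 - 2 / (a + 1) - (2 - 2 / a + (a ^+ 2)^-1) = (a - 1) / (a ^+ 2 * (a + 1)).
  by field; apply/andP; split; lra.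
by rewrite divr_ge0 ?mulr_ge0 ?sqr_ge0 //; lra.
Qed.

(** The integral of the series is the sum of the integrals, at most [M]; so the series is finite
    almost everywhere and its terms tend to 0. *)
Lemma integral_series_ae_cvg0 (R : realType) (d : measure_display)
    (Omega : measurableType d) (P : {measure set Omega -> \bar R})
    (D : nat -> Omega -> R) (c : nat -> R) (M : R) :
  (forall n, measurable_fun setT (D n)) -> (forall n w, 0 <= D n w) ->
  (forall n, \int[P]_w (D n w)%:E <= (c n)%:E)%E ->
  (forall n, \sum_(0 <= k < n) c k <= M) ->
  \forall w \ae P, D n w @[n --> \oo] --> (0 : R).
Proof.
move=> mD D0 intD cM.
have intS : P.-integrable setT (fun w => \sum_(n <oo) (D n w)%:E)%E.
  apply/integrableP; split.
    apply: ge0_emeasurable_sum => [n w _ _|n _]; first by rewrite lee_fin.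
    exact/measurable_EFinP.
  under eq_integral => w _.
    rewrite gee0_abs; last by apply: nneseries_ge0 => n _ _; rewrite lee_fin.
    over.
  rewrite integral_nneseries //; last 2 first.
  - by move=> n; apply/measurable_EFinP.
  - by move=> n w _; rewrite lee_fin.
  apply: (@le_lt_trans _ _ M%:E); last exact: ltry.
  apply: lime_le.
    by apply: is_cvg_nneseries => n _ _; apply: integral_ge0 => w _; rewrite lee_fin.
  apply: nearW => n; apply: (@le_trans _ _ (\sum_(0 <= k < n) (c k)%:E)%E).
    by apply: lee_sum => k _; exact: intD.
  by rewrite sumEFin lee_fin.
apply: filterS (integrable_ae measurableT intS) => w /(_ I) fin.
apply: cvg_series_cvg_0; apply: nondecreasing_is_cvgn.
  apply/nondecreasing_seqP => n; rewrite /series /= big_nat_recr //= lerDl //.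
exists (fine (\sum_(n <oo) (D n w)%:E)%E) => _ [n _ <-].
rewrite -lee_fin fineK // /series /= -sumEFin.
by apply: nneseries_lim_ge => k _ _; rewrite lee_fin.
Qed.

Lemma cvg_sqr0 (R : realType) (u : nat -> R) (q : R) :
  (u n - q) ^+ 2 @[n --> \oo] --> (0 : R) -> u n @[n --> \oo] --> q.
Proof.
move=> h; apply/cvgrPdist_lt => e e0; near=> n.
have : `|0 - (u n - q) ^+ 2| < e ^+ 2.
  by near: n; apply: (@cvgr_dist_lt _ _ _ _ _ _ _ h); rewrite exprn_gt0.
by rewrite sub0r normrN normrX distrC ltr_pXn2r // nnegrE ltW.
Unshelve. all: by end_near. Qed.

Lemma ex_floor_sqrt (n : nat) : (0 < n)%N ->
  exists k, (k.+1 ^ 2 <= n < k.+2 ^ 2)%N.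
Proof.
elim: n => // -[_ _|n IH _]; first by exists 0%N.
have [k /andP[kn nk]] := IH isT.
have [nk'|nk'] := ltnP n.+2 (k.+2 ^ 2); first by exists k; lia.
by exists k.+1; lia.
Qed.

(** For $(k+1)^2\le n<(k+2)^2$, monotonicity puts $s(n)/n$ between $s((k+1)^2)/(k+2)^2$ and
    $s((k+2)^2)/(k+1)^2$, and the ratio of consecutive squares tends to 1. *)
Lemma cvg_mean_of_squares (R : realType) (s : nat -> R) (q : R) :
  (forall n, 0 <= s n) -> {homo s : m n / (m <= n)%N >-> m <= n} ->
  (n.+1 ^ 2)%N%:R^-1 * s (n.+1 ^ 2)%N @[n --> \oo] --> q ->
  n%:R^-1 * s n @[n --> \oo] --> q.
Proof.
move=> s0 s_homo; set v := (X in X @ _ --> _) => vq.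
have /choice[kf kfP] n : exists k, (0 < n)%N -> (k.+1 ^ 2 <= n < k.+2 ^ 2)%N.
  by have [->|/ex_floor_sqrt[k]] := posnP n; [exists 0%N|exists k].
have kf_oo : kf n @[n --> \oo] --> \oo.
  apply/cvgnyPge => N; exists (N.+1 ^ 2)%N => // n /= Nn.
  have /kfP/andP[_ nk] : (0 < n)%N by lia.
  have : (N.+1 ^ 2 < (kf n).+2 ^ 2)%N by lia.
  by rewrite ltn_sqr; lia.
(* As [harmonic k] is $1/(k+1)$, this is $((k+2)/(k+1))^2$. *)
pose w k : R := (1 + harmonic k) * (1 + harmonic k).
have w1 : w k @[k --> \oo] --> (1 : R).
  have h1 : 1 + harmonic k @[k --> \oo] --> (1 + 0 : R).
    by apply: cvgD; [exact: cvg_cst|exact: cvg_harmonic].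
  rewrite [X in _ --> X](_ : _ = (1 + 0) * (1 + 0)); first exact: cvgM.
  by rewrite addr0 mulr1.
have lo : v k * (w k)^-1 @[k --> \oo] --> q.
  have -> : q = q * 1^-1 by rewrite invr1 mulr1.
  by apply: cvgM => //; apply: cvgV.
have up : v k.+1 * w k @[k --> \oo] --> q.
  rewrite -[X in _ --> X]mulr1; apply: cvgM => //.
  by rewrite (cvg_shiftS v).
apply: (@squeeze_cvgr _ _ _ _ (fun n => v (kf n) * (w (kf n))^-1)
   (fun n => v (kf n).+1 * w (kf n))); last 2 first.
- exact: (cvg_comp _ _ kf_oo lo).
- exact: (cvg_comp _ _ kf_oo up).
exists 1%N => // n /= n0; have /andP[kn nk] := kfP n n0.
have wE : w (kf n) = ((kf n).+2 ^ 2)%N%:R / ((kf n).+1 ^ 2)%N%:R.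
  rewrite /w /harmonic /= !natrX -expr_div_n -expr2; congr (_ ^+ 2).
  by rewrite -[X in _ = X / _]natr1 mulrDl divff ?pnatr_eq0 // mul1r.
have p1 : 0 < ((kf n).+1 ^ 2)%N%:R :> R by rewrite ltr0n expn_gt0.
have p2 : 0 < ((kf n).+2 ^ 2)%N%:R :> R by rewrite ltr0n expn_gt0.
have pn : 0 < n%:R :> R by rewrite ltr0n.
rewrite wE invf_div /v; apply/andP; split.
  rewrite [leLHS](_ : _ = ((kf n).+2 ^ 2)%N%:R^-1 * s ((kf n).+1 ^ 2)%N).
    by apply: ler_pM; rewrite ?invr_ge0 ?(ltW p2) ?s_homo // lef_pV2 ?posrE // ler_nat ltnW.
  by field; rewrite !gt_eqF.
rewrite [leRHS](_ : _ = ((kf n).+1 ^ 2)%N%:R^-1 * s ((kf n).+2 ^ 2)%N).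
  apply: ler_pM; rewrite ?invr_ge0 ?(ltW pn) ?s_homo ?(ltnW nk) //.
  by rewrite lef_pV2 ?posrE // ler_nat.
by field; rewrite !gt_eqF.
Qed.

(* The L2 bounds are summable along the squares; the counts being monotone, the
   convergence along the squares extends to all n. *)
Lemma strong_law_events (R : realType) (d : measure_display)
    (Omega : measurableType d) (P : probability Omega R)
    (A : nat -> set Omega) (q : R) :
  (forall i, measurable (A i)) -> (forall i, P (A i) = q%:E) ->
  (forall i j, i != j -> P (A i `&` A j) = (q * q)%:E) ->
  \forall w \ae P, n%:R^-1 * (\sum_(i < n) \1_(A i) w) @[n --> \oo] --> q.
Proof.
move=> mA PA PAA.
pose D n w : R := ((n.+1 ^ 2)%N%:R^-1 * (\sum_(i < n.+1 ^ 2) \1_(A i) w) - q) ^+ 2.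
have : \forall w \ae P, D n w @[n --> \oo] --> (0 : R).
  apply: (@integral_series_ae_cvg0 _ _ _ _ _ (fun n => (n.+1 ^ 2)%N%:R^-1) 2).
  - move=> n; apply: measurable_funX; apply: measurable_funB => //.
    apply: measurable_funM => //; apply: measurable_sum => i.
    exact: measurable_indic.
  - by move=> n w; exact: sqr_ge0.
  - by move=> n; apply: second_moment_mean => //; rewrite expn_gt0.
  - exact: sum_inv_squares_le.
apply: filterS => w /cvg_sqr0.
apply: (@cvg_mean_of_squares _ (fun n => \sum_(i < n) \1_(A i) w)).
  by move=> n; apply: sumr_ge0 => i _.
by apply/nondecreasing_seqP => n; rewrite big_ord_recr /= lerDl.
Qed.

(** * Measurability through dependence on finitely many values *)

(** Time 0 is left out because the cylinders carry no information on it. *)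
Definition agree_upto (S : Type) (N : nat) (x y : nat -> nat -> S) : Prop :=
  forall i s, (i < N)%N -> (0 < s <= N)%N -> x i s = y i s.

Definition finitely_determined (S U : Type) (F : (nat -> nat -> S) -> U) : Prop :=
  exists N, forall x y, agree_upto N x y -> F x = F y.

Lemma agree_uptoW (S : Type) (M N : nat) (x y : nat -> nat -> S) :
  (M <= N)%N -> agree_upto N x y -> agree_upto M x y.
Proof.
move=> MN xy i s iM /andP[s0 sM]; apply: xy; first exact: leq_trans MN.
by rewrite s0 (leq_trans sM).
Qed.

(** As [S] is finite, the relevant values take finitely many configurations; the event is a finite
    union of their fibres, each a finite intersection of measurable sets. *)
Lemma measurable_finitely_determined (d : measure_display)
    (Omega : measurableType d) (S : finType) (U : Type)
    (Z : Omega -> nat -> nat -> S) (F : (nat -> nat -> S) -> U) (B : set U) :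
  (forall i s v, (0 < s)%N -> measurable [set w | Z w i s = v]) ->
  finitely_determined F -> measurable [set w | B (F (Z w))].
Proof.
move=> mZ [N FN].
pose code w : {ffun 'I_N * 'I_N -> S} := [ffun ij : 'I_N * 'I_N => Z w ij.1 ij.2.+1].
have codeF w w' : code w = code w' -> F (Z w) = F (Z w').
  move=> cc; apply: FN => i [//|s] iN /= sN.
  by have /ffunP/(_ (Ordinal iN, Ordinal sN)) := cc; rewrite !ffunE.
have mcode h : measurable [set w | code w = h].
  pose E (ij : 'I_N * 'I_N) := [set w | Z w ij.1 ij.2.+1 = h ij].
  have -> : [set w | code w = h] = \bigcap_(ij in setT) E ij.
    apply/seteqP; split => w /=.
      by move=> ch ij _; rewrite /E /= -ch ffunE.
    by move=> Zh; apply/ffunP => ij; rewrite ffunE; exact: Zh.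
  by apply: fin_bigcap_measurable => // ij _; exact: mZ.
have -> : [set w | B (F (Z w))] =
    \bigcup_(h in [set h | exists2 w, code w = h & B (F (Z w))]) [set w | code w = h].
  apply/seteqP; split => w /=; first by move=> BF; exists (code w) => //; exists w.
  by move=> [_ [w' <- BF] /= /codeF ->].
by apply: fin_bigcup_measurable.
Qed.

Lemma best_ext (R : realType) (S : Type) (f : S -> R) (N t : nat) (x y : nat -> S) :
  (0 < N)%N -> (t <= N)%N -> (forall s, (0 < s <= N)%N -> x s = y s) ->
  best f x t = best f y t.
Proof.
(* The default of the minimum involves [x 1], which is covered because [N] is positive. *)
move=> N0 tN xy; rewrite /best xy // big_nat_cond [RHS]big_nat_cond.
apply: eq_bigr => s /andP[/andP[s0 st] _]; rewrite xy // s0 /=.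
exact: leq_trans tN.
Qed.

Section FiniteDetermination.
Context (R : realType) (S : Type) (f : S -> R).

Lemma phat_ext (N r T : nat) (x y : nat -> nat -> S) :
  (0 < N)%N -> (r <= N)%N -> (T <= N)%N -> agree_upto N x y ->
  phat f x r T = phat f y r T.
Proof.
move=> N0 rN TN xy.
have bE i t : (i < N)%N -> (t <= N)%N -> best f (x i) t = best f (y i) t.
  by move=> iN tN; apply: (@best_ext _ _ _ N) => // s; exact: xy.
have oE : best_overall f x r T = best_overall f y r T.
  rewrite /best_overall bE //; apply: eq_bigr => i _.
  rewrite big_nat_cond [RHS]big_nat_cond; apply: eq_bigr => t /andP[/andP[_ tT] _].
  by rewrite bE // ?(leq_trans (ltn_ord i)) // (leq_trans _ TN).
apply/funext => t; rewrite /phat oE; case: ifP => // /andP[_ tT].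
congr (_ * _); apply: eq_bigr => i _; rewrite bE // ?(leq_trans tT) //.
exact: leq_trans (ltn_ord i) rN.
Qed.

Context (lam : R) (fr fT : nat -> nat) (r0 T0 : nat).
Local Notation restart := (fun x => restart f x lam fr fT r0 T0).

(** The path of the parameters depends on the trajectories, but a bound [N] uniform over all of them
    (take [y = x]) shows that step [k] looks only at a fixed finite block. *)
Lemma restart_bounded_ext (k : nat) : exists N, forall x y, agree_upto N x y ->
  [/\ (0 < N)%N, restart x k = restart y k,
      ((restart x k).1 <= N)%N & ((restart x k).2 <= N)%N].
Proof.
elim: k => [|k [N IH]].
  by exists (r0 + T0).+1 => x y _; split => //=; lia.
(* [fr] and [fT] may fail to be monotone, so the maximum runs over all arguments up to [N]. *)
pose M := (\max_(n < N.+1) (fr n + fT n))%N.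
exists (N + M)%N => x y xy.
have [N0 E rN TN] := IH x y (agree_uptoW (leq_addr _ _) xy).
have frM n : (n <= N)%N -> (fr n + fT n <= M)%N.
  by move=> nN; apply: (@leq_bigmax _ (fun n : 'I_N.+1 => fr n + fT n)%N (Ordinal (nN : n < N.+1)%N)).
rewrite /= -E; move: rN TN; case: (restart x k) => r T /= rN TN.
have := frM _ rN; have := frM _ TN => fTM frM'.
rewrite /sigma_hat (@phat_ext (N + M) r T x y) //; [|lia..].
by split; [lia|by []|case: ifP => _ /=; lia|case: ifP => _ /=; lia].
Qed.

Lemma phat_at_finitely_determined (k t : nat) :
  finitely_determined (fun x => phat_at f x lam fr fT r0 T0 k t).
Proof.
have [N NP] := restart_bounded_ext k; exists N => x y xy.
have [N0 E rN TN] := NP x y xy; rewrite /phat_at -E.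
by case: Defs.restart rN TN => r T /= rN TN; rewrite (phat_ext N0 rN TN xy).
Qed.

Lemma sigma_hat_at_finitely_determined (k : nat) :
  finitely_determined (fun x => sigma_hat_at f x lam fr fT r0 T0 k).
Proof.
have [N NP] := restart_bounded_ext k; exists N => x y xy.
have [N0 E rN TN] := NP x y xy; rewrite /sigma_hat_at -E.
case: Defs.restart rN TN => r T /= rN TN.
by rewrite /sigma_hat (phat_ext N0 rN TN xy).
Qed.

End FiniteDetermination.

Lemma measurable_cvg_set (R : realType) (d : measure_display)
    (Omega : measurableType d) (u : nat -> Omega -> R) (l : R) :
  (forall k (B : set R), measurable [set w | B (u k w)]) ->
  measurable [set w | u k w @[k --> \oo] --> l].
Proof.
move=> mu.
have -> : [set w | u k w @[k --> \oo] --> l] =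
    \bigcap_n \bigcup_K \bigcap_k [set w | (K <= k)%N -> `|l - u k w| < n.+1%:R^-1].
  apply/seteqP; split => w /=.
    move=> /cvgrPdist_lt ul n _.
    have n0 : 0 < (n.+1%:R^-1 : R) by rewrite invr_gt0 ltr0n.
    have [K _ KP] := ul _ n0.
    by exists K => // k _ /= Kk; exact: KP.
  move=> h; apply/cvgrPdist_lt => e e0.
  have [n _ nP] := near_infty_natSinv_lt (PosNum e0).
  have [K _ KP] := h n I; exists K => // k /= Kk.
  apply: lt_trans (KP k I Kk) _; exact: (nP n (leqnn n)).
apply: bigcapT_measurable => n; apply: bigcupT_measurable => K.
apply: bigcapT_measurable => k.
exact: (mu k [set y | (K <= k)%N -> `|l - y| < n.+1%:R^-1]).
Qed.

Lemma probability_ae_eq1 (R : realType) (d : measure_display)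
    (Omega : measurableType d) (P : probability Omega R) (E : set Omega) :
  measurable E -> (\forall w \ae P, E w) -> P E = 1%E.
Proof.
move=> mE /(measure_negligible (measurableC mE)) /= PE0.
by rewrite -[E]setCK probability_setC ?PE0 ?sube0 //; exact: measurableC.
Qed.

(** * Almost sure properties of the i.i.d. replications *)

Section Replications.
Context (R : realType) (d : measure_display) (Omega : measurableType d)
  (P : probability Omega R) (S : finType) (f : S -> R) (fm : R)
  (X : nat -> Omega -> nat -> S) (X_iid : iid_replications P X).

Local Notation failure t := [set x : nat -> S | fm < best f x t].

Lemma measurable_trajectory_value (i s : nat) (v : S) : (0 < s)%N ->
  measurable [set w | X i w s = v].
Proof.
move=> s0; have [Xm _ _] := X_iid.
apply: (Xm i [set x | x s = v]); apply: sub_sigma_algebra.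
by exists s, v.
Qed.

Lemma trajectory_measurable_failure (t : nat) : trajectory_measurable (failure t).
Proof.
(* A pointed structure on trajectories makes them a measurable space under the cylinder
   sigma-algebra; the point is a value of [X 0]. The failure set is then an event for the identity
   process on that space. *)
pose ptd : pointedType :=
  HB.pack_for pointedType (nat -> S) (gen_eqMixin (nat -> S))
    (gen_choiceMixin (nat -> S)) (isPointed.Build (nat -> S) (X 0%N point)).
have := @measurable_finitely_determined _
  (g_sigma_algebraType (@trajectory_cylinders S : set (set ptd))) S _
  (fun (x : nat -> S) (_ : nat) s => x s) (fun y => fm < best f (y 0%N) t) is_true.
apply.
  by move=> _ s v s0; apply: sub_sigma_algebra; exists s, v.
exists t.+1 => x y xy; congr (_ < _).
by apply: (@best_ext _ _ _ t.+1) => // s; exact: xy.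
Qed.

Local Notation p := (failure_prob P f fm (X 0%N)).

Lemma measurable_failure (i t : nat) : measurable (X i @^-1` failure t).
Proof. by case: X_iid => Xm _ _; exact: Xm (trajectory_measurable_failure t). Qed.

Lemma probability_failure (i t : nat) : P (X i @^-1` failure t) = (p t)%:E.
Proof.
have [_ _ /(_ i 0%N _ (trajectory_measurable_failure t)) ->] := X_iid.
by rewrite /failure_prob fineK // fin_num_measure //; exact: (measurable_failure 0 t).
Qed.

Lemma probability_failure2 (i j t : nat) : i != j ->
  P ((X i @^-1` failure t) `&` (X j @^-1` failure t)) = (p t * p t)%:E.
Proof.
move=> ij; have [_ /(_ [:: i; j] (fun=> failure t)) indep _] := X_iid.
have uij : uniq [:: i; j] by rewrite /= inE ij.
have := indep uij (fun _ _ => trajectory_measurable_failure t).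
rewrite !big_cons big_nil mule1 !probability_failure EFinM => <-; congr (P _).
apply/seteqP; split => w /=.
  by move=> [wi wj] k /=; rewrite !inE => /orP[] /eqP ->.
by move=> h; split; apply: h => /=; rewrite !inE eqxx ?orbT.
Qed.

Lemma fail_freq_ae_cvg : \forall w \ae P, forall t, (0 < t)%N ->
  fail_freq f fm (X^~ w) t n @[n --> \oo] --> p t.
Proof.
suff : \forall w \ae P, forall t, fail_freq f fm (X^~ w) t n @[n --> \oo] --> p t.
  by apply: filterS => w h t _; exact: h.
apply: ae_foralln => t.
have := @strong_law_events _ _ _ P (fun i => X i @^-1` failure t) (p t)
  (measurable_failure^~ t) (probability_failure^~ t).
move=> /(_ (fun i j => @probability_failure2 i j t)); apply: filterS => w.
suff -> : fail_freq f fm (X^~ w) t =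
  (fun n => n%:R^-1 * \sum_(i < n) \1_(X i @^-1` failure t) w) by [].
apply/funext => n; congr (_ * _).
by apply: eq_bigr => i _; rewrite indicE /= mem_setE.
Qed.

(** Never hitting the minimum implies failure at every time, so its probability is at most $p(t)$
    for all $t\ge1$, hence 0. *)
Lemma ae_hits : is_min_value f fm -> p t @[t --> \oo] --> (0 : R) ->
  \forall w \ae P, forall i, exists2 t, (0 < t)%N & best f (X i w) t = fm.
Proof.
move=> [_ fmP] p0; apply: ae_foralln => i.
pose N := \bigcap_t (X i @^-1` failure t.+1).
have mN : measurable N.
  by apply: bigcapT_measurable => t; exact: measurable_failure.
exists N; split => //; last first.
  move=> w /= /forall2NP noh t _ /=; case: (noh t.+1) => // /eqP.
  by rewrite lt_neqAle best_ge // andbT eq_sym.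
apply/eqP; rewrite -measure_le0; apply/lee_addgt0Pr => e e0; rewrite add0e.
have [t _ tP] : \forall t \near \oo, p t < e by apply: (cvgr_lt _ p0).
apply: (@le_trans _ _ (P (X i @^-1` failure t.+1))).
  apply: le_measure; rewrite ?inE //; first exact: measurable_failure.
  by move=> w; exact.
by rewrite probability_failure lee_fin ltW // tP /=.
Qed.

End Replications.

(** * From almost sure convergence to measurable events of probability one *)

Theorem mainTheorem4 (R : realType) (d : measure_display)
    (Omega : measurableType d) (P : probability Omega R)
    (S : finType) (f : S -> R) (fm : R) (fm_min : is_min_value f fm)
    (X : nat -> Omega -> nat -> S) (X_iid : iid_replications P X)
    (p := failure_prob P f fm (X 0%N))
    (p_cvg0 : p t @[t --> \oo] --> (0 : R))
    (tm : nat)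
    (tm_min : is_min_point (gfun p) tm)
    (tm_uniq : forall t, is_min_point (gfun p) t -> t = tm)
    (g_decr : forall s t, (0 < s)%N -> (s < t)%N -> (t <= tm)%N ->
                (gfun p t < gfun p s)%E)
    (p1_lt1 : p 1%N < 1)
    (r0 T0 : nat) (r0_gt0 : (0 < r0)%N) (T0_gt0 : (0 < T0)%N)
    (lam : R) (lam_gt0 : 0 < lam) (lam_lt1 : lam < 1)
    (fr fT : nat -> nat)
    (fr_gt : forall x, (0 < x)%N -> (x < fr x)%N)
    (fT_gt : forall x, (0 < x)%N -> (x < fT x)%N) :
  let T := `|Num.ceil (tm%:R / lam)|%N in
  P (\bigcap_(t in [set t | (1 <= t <= T)%N])
       [set w | phat_at f (X^~ w) lam fr fT r0 T0 k t @[k --> \oo] --> p t])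
    = 1%E
  /\
  P [set w | ((sigma_hat_at f (X^~ w) lam fr fT r0 T0 k)%:R : R) @[k --> \oo]
               --> (tm%:R : R)] = 1%E.
Proof.
move=> T.
have ae_cvg : \forall w \ae P,
    (forall t, (1 <= t <= T)%N ->
       phat_at f (X^~ w) lam fr fT r0 T0 k t @[k --> \oo] --> p t) /\
    ((sigma_hat_at f (X^~ w) lam fr fT r0 T0 k)%:R : R) @[k --> \oo]
      --> (tm%:R : R).
  apply: filterS2 (fail_freq_ae_cvg f fm X_iid) (ae_hits X_iid fm_min p_cvg0).
  move=> w freq_cvg hits; exact: (restart_cvg (proj2 fm_min) freq_cvg hits).
have mX i s v := @measurable_trajectory_value _ _ _ _ _ _ X_iid i s v.
split; apply: probability_ae_eq1.
(* The index set of the intersection must be nonempty: it contains 1, since $t_m/\lambda>0$. *)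
- apply: bigcap_measurable => [|t _]; first exists 1%N => /=.
    have q0 : 0 < tm%:R / lam by rewrite divr_gt0 // ltr0n; case: tm_min.
    by rewrite ltn_absz_ceil // ltW.
  apply: measurable_cvg_set => k B.
  exact: (measurable_finitely_determined _ mX (phat_at_finitely_determined f lam fr fT r0 T0 k t)).
- by apply: filterS ae_cvg => w [].
- apply: measurable_cvg_set => k B.
  exact: (measurable_finitely_determined (fun n => B n%:R) mX
    (sigma_hat_at_finitely_determined f lam fr fT r0 T0 k)).
- by apply: filterS ae_cvg => w [].
Qed.
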